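(* Let $G=(V,E,w)$ be a finite connected graph with $|V|=n\ge2$ and weights $w:E\to\mathbb{R}_{>0}$, and let $\alpha\in(0,1/2]$ and $K$ be real constants. Suppose that every $S\subseteq V$ with $G[S]$ connected and $|S|\ge2$ admits a connected $\alpha$-balanced fragmentation. (i) If $\operatorname{frag}_\alpha(S)\le K$ for every such $S$, then $$\frac{\operatorname{OPT}_{\mathrm{card}}(G,w)}{\operatorname{OPT}_{\mathrm{free}}(G,w)}\le K\left(1+\left\lfloor\log_{1/(1-\alpha)}(n-1)\right\rfloor\right).$$ (ii) If $\eta>0$ and $\operatorname{frag}_\alpha(S)\le K/(|S|-1)^{\eta}$ for every such $S$, then $$\frac{\operatorname{OPT}_{\mathrm{card}}(G,w)}{\operatorname{OPT}_{\mathrm{free}}(G,w)}\le\frac{K(1-\alpha)^{-\eta}}{1-(1-\alpha)^{\eta}}.$$ (iii) If $\theta>0$ and $\operatorname{frag}_\alpha(S)\le K(|S|-1)^{\theta}$ for every such $S$, then $$\frac{\operatorname{OPT}_{\mathrm{card}}(G,w)}{\operatorname{OPT}_{\mathrm{free}}(G,w)}\le\frac{K(n-1)^{\theta}}{1-(1-\alpha)^{\theta}}.$$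
   Context: Fragmentation. For $S\subseteq V$ with $G[S]$ connected, $W(S)=\sum_{xy\in E(G[S])}w_{xy}$; for disjoint $A,B\subseteq V$, $w(A,B)$ is the total weight of edges with one endpoint in $A$ and the other in $B$. A connected $\alpha$-balanced fragmentation of $S$ is a bipartition $S=A\mathbin{\dot\cup}B$ with $G[A],G[B]$ connected (nonempty) and $\max\{|A|-1,|B|-1\}\le(1-\alpha)(|S|-1)$. For connected $S$ with $|S|\ge2$, $\operatorname{frag}_\alpha(S)$ is the minimum of $(|S|-1)w(A,B)/W(S)$ over all connected $\alpha$-balanced fragmentations of $S$ ($+\infty$ if there are none). Optima. $d_G$ is the shortest-path metric of $(V,E)$ with every edge of length $1$ (weights are not lengths). $\operatorname{OPT}_{\mathrm{free}}(G,w)$ is the minimum of $\sum_{xy\in E}w_{xy}u(x,y)$ over all ultrametrics $u$ on $V$ (metrics with $u(x,y)\le\max\{u(x,z),u(z,y)\}$) with $u\ge d_G$ on all pairs. A rooted binary hierarchy $H$ on $V$ is a rooted tree whose leaves are the vertices of $V$ and whose internal nodes have exactly two children; $C_H(x,y)$ is the set of leaves below the lowest common ancestor of $x,y$; $h_H(x,x)=0$ and $h_H(x,y)=|C_H(x,y)|-1$ for $x\ne y$. $\operatorname{OPT}_{\mathrm{card}}(G,w)$ is the minimum of $\sum_{xy\in E}w_{xy}h_H(x,y)$ over all rooted binary hierarchies $H$ on $V$ with $h_H\ge d_G$ on all pairs. *)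

(* Defs.v *)
From HB Require Import structures.
From mathcomp Require Import all_boot all_order all_algebra.
From mathcomp Require Import all_classical all_reals all_analysis.

Set Implicit Arguments.
Unset Strict Implicit.
Unset Printing Implicit Defensive.

Import Order.TTheory GRing.Theory Num.Theory.
Local Open Scope ring_scope.

(* A weighted graph on [V] is an adjacency relation [e : rel V] with a function
   [w : V -> V -> R] of which only the values on adjacent pairs are used. *)

Record simple_graph (V : finType) (e : rel V) : Prop := SimpleGraph {
  graph_sym : symmetric e;
  graph_irr : irreflexive e }.

Record edge_weight (R : realType) (V : finType) (e : rel V) (w : V -> V -> R)
    : Prop := EdgeWeight {
  weight_sym : forall x y, e x y -> w x y = w y x;
  weight_gt0 : forall x y, e x y -> 0 < w x y }.

Section Graph.
Variables (R : realType) (V : finType) (e : rel V) (w : V -> V -> R).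

Definition induced_adj (S : {set V}) : rel V :=
  [rel x y | [&& x \in S, y \in S & e x y]].

Definition connected_in (S : {set V}) : bool :=
  (S != finset.set0) &&
  [forall x in S, forall y in S, connect (induced_adj S) x y].

(* A shortest walk visits no vertex twice, so its length is less than [#|V|];
   on a connected graph the default value [#|V|] of the minimum never shows. *)
Definition graph_dist (x y : V) : nat :=
  \big[minn/#|V|]_(k < #|V| |
     [exists p : k.-tuple V, path e x p && (last x p == y)]) k.

(* Each unordered edge occurs as two ordered pairs, whence the factor 1/2. *)
Definition edge_sum (S : {set V}) (f : V -> V -> R) : R :=
  2^-1 * \sum_(x in S) \sum_(y in S | e x y) f x y.

Definition weight_in (S : {set V}) : R := edge_sum S w.

(* Used for disjoint [A] and [B] only: every edge is then counted once. *)
Definition cut_weight (A B : {set V}) : R :=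
  \sum_(x in A) \sum_(y in B | e x y) w x y.

Definition balanced_fragmentation (alpha : R) (S A B : {set V}) : bool :=
  [&& A :|: B == S, [disjoint A & B], connected_in A, connected_in B
    & Num.max (#|A|%:R - 1) (#|B|%:R - 1) <= (1 - alpha) * (#|S|%:R - 1)].

Definition frag (alpha : R) (S : {set V}) : \bar R :=
  \big[Order.min/+oo%E]_(AB : {set V} * {set V} |
       balanced_fragmentation alpha S AB.1 AB.2)
    ((#|S|%:R - 1) * cut_weight AB.1 AB.2 / weight_in S)%:E.

Record is_metric (u : V -> V -> R) : Prop := IsMetric {
  metric_ge0 : forall x y, 0 <= u x y;
  metric_eq0 : forall x y, u x y = 0 <-> x = y;
  metric_sym : forall x y, u x y = u y x;
  metric_triangle : forall x y z, u x y <= u x z + u z y }.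

Definition is_ultrametric (u : V -> V -> R) : Prop :=
  is_metric u /\ forall x y z, u x y <= Num.max (u x z) (u z y).

Definition dominates_dist (u : V -> V -> R) : Prop :=
  forall x y, (graph_dist x y)%:R <= u x y.

Definition cost (u : V -> V -> R) : R :=
  edge_sum [set: V] (fun x y => w x y * u x y).

(* On a connected graph with positive weights the infimum is a minimum: an
   ultrametric is at most the largest of its values on the edges, so feasible
   ultrametrics of bounded cost are bounded, and the constraints are closed
   ([u x y >= 1] for [x <> y] follows from domination). *)
Definition opt_free : R :=
  inf [set cost u | u in
        [set u | is_ultrametric u /\ dominates_dist u]%classic]%classic.

End Graph.

Section Hierarchy.
Variable V : finType.

(* Rooted binary trees with leaves labelled in [V].  The order of the children
   is immaterial for what follows. *)
Inductive bintree := Leaf of V | Node of bintree & bintree.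

Fixpoint leaves (H : bintree) : seq V :=
  match H with
  | Leaf x => [:: x]
  | Node l r => leaves l ++ leaves r
  end.

Definition is_hierarchy (H : bintree) : bool := perm_eq (leaves H) (enum V).

(* The subtree rooted at the lowest common ancestor, for leaves [x], [y]. *)
Fixpoint lca (H : bintree) (x y : V) : bintree :=
  match H with
  | Leaf _ => H
  | Node l r =>
      if (x \in leaves l) && (y \in leaves l) then lca l x y
      else if (x \in leaves r) && (y \in leaves r) then lca r x y
      else H
  end.

Definition lca_leaves (H : bintree) (x y : V) : {set V} :=
  [set z in leaves (lca H x y)].

Definition hheight (R : realType) (H : bintree) (x y : V) : R :=
  if x == y then 0 else #|lca_leaves H x y|%:R - 1.

End Hierarchy.

(* The cost depends only on [lca_leaves H], one of finitely many maps,
   and a connected graph has a feasible hierarchy (one whose subtrees all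
   have a connected leaf set), so on such a graph the infimum is a minimum. *)
Definition opt_card (R : realType) (V : finType) (e : rel V) (w : V -> V -> R)
    : R :=
  inf [set cost e w (hheight R H) | H in
        [set H | is_hierarchy H /\ dominates_dist e (hheight R H)]%classic]%classic.

Definition logb (R : realType) (b x : R) : R := ln x / ln b.

(* Main.v *)
(* Every feasible ultrametric is at least 1 on each edge, so OPT_free >= W(V).
   Conversely, splitting V recursively along fragmentations of least ratio
   gives a hierarchy with connected clusters, hence h_H >= d_G, whose cost is
   the sum over its clusters S of (|S| - 1) w(A, B) = frag(S) W(S).  Charging
   frag(S) W(S) to the edges inside S, an edge pays the sum of frag over the
   clusters containing it; along this chain |S| - 1 shrinks by the factor
   1 - alpha at each step and stays at least 1, so the sum is bounded by the
   length of the chain in (i) and by a geometric series in (ii) and (iii). *)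
Require Import Defs.
From HB Require Import structures.
From mathcomp Require Import all_boot all_order all_algebra.
From mathcomp Require Import all_classical all_reals all_analysis.
From mathcomp Require Import lra ring.

Import Order.TTheory GRing.Theory Num.Theory.
Local Open Scope ring_scope.

Set Implicit Arguments.
Unset Strict Implicit.

(** * Edge sums, cluster weights and distances inside connected sets *)

Section GraphSums.
Variables (R : realType) (V : finType) (e : rel V).
Implicit Types (S A B : {set V}) (f g w : V -> V -> R).

Lemma sum_setU_disjoint A B (h : V -> R) : [disjoint A & B] ->
  \sum_(y in A :|: B) h y = \sum_(y in A) h y + \sum_(y in B) h y.
Proof.
by move=> dAB; rewrite -bigU //=; apply: eq_bigl => y; rewrite !inE.
Qed.

Lemma sum_setU_disjoint_cond A B (P : pred V) (h : V -> R) : [disjoint A & B] ->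
  \sum_(y in A :|: B | P y) h y
  = \sum_(y in A | P y) h y + \sum_(y in B | P y) h y.
Proof. by move=> dAB; rewrite !big_mkcondr sum_setU_disjoint. Qed.

(** Each crossing edge occurs in both orders, from [A] to [B] and from [B] to [A]; the symmetry of
    [f] on edges makes the two contributions equal, which cancels the factor 1/2. *)
Lemma edge_sumU A B f : symmetric e -> [disjoint A & B] ->
    (forall x y, e x y -> f x y = f y x) ->
  edge_sum e (A :|: B) f
  = edge_sum e A f + edge_sum e B f + \sum_(x in A) \sum_(y in B | e x y) f x y.
Proof.
move=> symE dAB symf.
have cross : \sum_(x in B) \sum_(y in A | e x y) f x y
    = \sum_(x in A) \sum_(y in B | e x y) f x y.
  rewrite (exchange_big_dep (mem A)) /=; last by move=> x y _ /andP[].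
  apply: eq_bigr => x xA; apply: eq_big => [y|y /andP[_ exy]].
    by rewrite xA symE.
  by apply: symf; case/andP: exy.
rewrite /edge_sum.
rewrite sum_setU_disjoint //.
under eq_bigr => x _ do rewrite sum_setU_disjoint_cond //.
under [X in _ + X]eq_bigr => x _ do rewrite sum_setU_disjoint_cond //.
rewrite !big_split /= cross; lra.
Qed.

Lemma ler_edge_sum S f g :
    {in S &, forall x y, e x y -> f x y <= g x y} ->
  edge_sum e S f <= edge_sum e S g.
Proof.
move=> le_fg; rewrite /edge_sum ler_wpM2l ?invr_ge0 //.
by apply: ler_sum => x xS; apply: ler_sum => y /andP[yS exy]; apply: le_fg.
Qed.

Lemma eq_edge_sum S f g :
    {in S &, forall x y, e x y -> f x y = g x y} ->
  edge_sum e S f = edge_sum e S g.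
Proof.
move=> eq_fg; rewrite /edge_sum; congr (_ * _).
by apply: eq_bigr => x xS; apply: eq_bigr => y /andP[yS exy]; apply: eq_fg.
Qed.

Lemma edge_sum_ge0 S f :
  {in S &, forall x y, e x y -> 0 <= f x y} -> 0 <= edge_sum e S f.
Proof.
move=> f_ge0; rewrite /edge_sum mulr_ge0 ?invr_ge0 //.
by apply: sumr_ge0 => x xS; apply: sumr_ge0 => y /andP[yS exy]; apply: f_ge0.
Qed.

Lemma cut_weight_ge0 w A B : edge_weight e w -> 0 <= cut_weight e w A B.
Proof.
move=> [_ w_gt0]; apply: sumr_ge0 => x _; apply: sumr_ge0 => y /andP[_ exy].
exact/ltW/w_gt0.
Qed.

Lemma weight_in_ge0 w S : edge_weight e w -> 0 <= weight_in e w S.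
Proof. by move=> [_ w_gt0]; apply: edge_sum_ge0 => x y _ _ /w_gt0/ltW. Qed.

Lemma weight_inU_ge w A B :
    symmetric e -> edge_weight e w -> [disjoint A & B] ->
  weight_in e w A + weight_in e w B <= weight_in e w (A :|: B).
Proof.
move=> symE wP dAB; rewrite /weight_in edge_sumU //; last first.
  by case: wP => symw _ x y /symw.
by rewrite lerDl; apply: cut_weight_ge0.
Qed.

(** The first step of a walk inside [S] between two distinct vertices is an edge of [G[S]], and its
    weight is positive. *)
Lemma weight_in_gt0 w S : edge_weight e w ->
  connected_in e S -> (2 <= #|S|)%N -> 0 < weight_in e w S.
Proof.
move=> [symw w_gt0] /andP[_ /forall_inP conn] /card_gt1P[x [y [xS yS neq_xy]]].
have /connectP[[|z p] /= pth lst] := forall_inP (conn x xS) y yS.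
  by rewrite lst eqxx in neq_xy.
case/andP: pth => /and3P[_ zS exz] _.
rewrite /weight_in /edge_sum mulr_gt0 ?invr_gt0 //.
rewrite (bigD1 x) //= ltr_wpDr //.
  by apply: sumr_ge0 => a _; apply: sumr_ge0 => b /andP[_ /w_gt0/ltW].
rewrite (bigD1 z) /= ?zS // ltr_wpDr ?w_gt0 //.
by apply: sumr_ge0 => b /andP[/andP[_ /w_gt0/ltW]].
Qed.

Lemma frag_ge0 w alpha S : edge_weight e w -> (0 < #|S|)%N ->
  (0 <= frag e w alpha S)%E.
Proof.
move=> wP S_gt0; rewrite /frag; apply: le_bigmin => [|AB _]; first exact: leey.
rewrite lee_fin divr_ge0 ?weight_in_ge0 // mulr_ge0 ?cut_weight_ge0 //.
by rewrite subr_ge0 ler1n.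
Qed.

(** A finite bound excludes the default [+oo], so some fragmentation meets it; [W(S) > 0] clears the
    denominator. *)
Lemma frag_leP w alpha S (k : R) : edge_weight e w ->
    connected_in e S -> (2 <= #|S|)%N -> (frag e w alpha S <= k%:E)%E ->
  exists A B, balanced_fragmentation e alpha S A B /\
    (#|S|%:R - 1) * cut_weight e w A B <= k * weight_in e w S.
Proof.
move=> wP Sconn S_ge2 /bigmin_leP[|[[A B] /= bal]]; first by rewrite leye_eq.
rewrite lee_fin ler_pdivrMr ?weight_in_gt0 // => le_cut.
by exists A, B.
Qed.

(** A path without repeated vertices has fewer than [#|V|] edges, so its length lies in the index
    range of the minimum. *)
Lemma graph_dist_path x p : path e x p -> uniq (x :: p) ->
  (graph_dist e x (last x p) <= size p)%N.
Proof.
move=> pth unq; have p_lt : (size p < #|V|)%N.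
  by have := max_card (mem (x :: p)); rewrite (card_uniqP unq).
rewrite /graph_dist; apply: (@bigmin_inf _ nat _ _ (Ordinal p_lt)) => //=.
by apply/existsP; exists (in_tuple p); rewrite pth eqxx.
Qed.

Lemma graph_dist_refl x : graph_dist e x x = 0%N.
Proof. by apply/eqP; rewrite -leqn0; apply: (@graph_dist_path x [::]). Qed.

Lemma graph_dist_gt0 x y : x != y -> (0 < graph_dist e x y)%N.
Proof.
move=> neq_xy; rewrite /graph_dist; apply: (@lt_bigmin _ nat) => [|k].
  by rewrite ltEnat; apply/card_gt0P; exists x.
case/existsP => p /andP[_ lst]; rewrite ltEnat /=.
case: (posnP k) => // k0; have /size0nil p0 : size p = 0%N by rewrite size_tuple.
by rewrite p0 /= (negPf neq_xy) in lst.
Qed.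

Lemma graph_dist_le_card x y : (graph_dist e x y <= #|V|)%N.
Proof. exact: (@bigmin_le_id _ nat). Qed.

Lemma path_induced S x p : path (induced_adj e S) x p ->
  path e x p /\ {subset p <= S}.
Proof.
elim: p x => [|y p IHp] x //= /andP[/and3P[_ yS ->]] /IHp[-> pS].
by split=> // z; rewrite inE => /predU1P[->|/pS].
Qed.

(** A walk in [S] shortens to one with distinct vertices, hence with at most [#|S| - 1] edges. So
    the height of a connected cluster dominates the distances in it. *)
Lemma graph_dist_connected S x y : connected_in e S -> x \in S -> y \in S ->
  (graph_dist e x y < #|S|)%N.
Proof.
move=> /andP[_ /forall_inP conn] xS yS.
have /connectP[p0 pth0 ->] := forall_inP (conn x xS) y yS.
case/shortenP: pth0 => p /path_induced[pth pS] unq _.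
apply: (@leq_trans #|x :: p|).
  by rewrite (card_uniqP unq) ltnS graph_dist_path.
apply/subset_leq_card/fintype.subsetP => z.
by rewrite inE => /predU1P[->|/pS].
Qed.

End GraphSums.

(** * Heights of pairs of leaves in a binary tree *)

Section HeightFunction.
Variables (R : realType) (V : finType).
Implicit Types (H l r : bintree V).

Lemma hheight_sym H x y : hheight R H x y = hheight R H y x.
Proof.
have lcaC : lca H x y = lca H y x.
  by elim: H => //= l -> r ->; rewrite !(andbC (y \in _)).
by rewrite /hheight /lca_leaves lcaC eq_sym.
Qed.

Lemma hheight_left l r x y : x \in leaves l -> y \in leaves l ->
  hheight R (Node l r) x y = hheight R l x y.
Proof. by move=> xl yl; rewrite /hheight /lca_leaves /= xl yl. Qed.

(** [lca] tries the left subtree first, hence the condition that [x] is not a leaf there. *)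
Lemma hheight_right l r x y : x \in leaves r -> y \in leaves r ->
  x \notin leaves l -> hheight R (Node l r) x y = hheight R r x y.
Proof. by move=> xr yr /negPf xl; rewrite /hheight /lca_leaves /= xr yr xl. Qed.

Lemma hheight_cross l r x y : x \in leaves l -> y \in leaves r ->
    x \notin leaves r -> y \notin leaves l ->
  hheight R (Node l r) x y = #|[set z in leaves l ++ leaves r]|%:R - 1.
Proof.
move=> xl yr /negPf xr /negPf yl; rewrite /hheight /lca_leaves /= yl xr andbF /=.
by case: eqP yl => // <-; rewrite xl.
Qed.

End HeightFunction.

(** * Recursive fragmentation and the comparison of the two optima *)

Section FragmentationTree.
Variables (R : realType) (V : finType) (e : rel V) (w : V -> V -> R).
Variables (alpha : R) (F g : nat -> R).
Hypotheses (graph_e : simple_graph e) (weight_w : edge_weight e w).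
Hypothesis F_ge0 : forall m, 0 <= F m.
(** Per unit of edge weight, a cluster of size [m] pays [g m] for its own cut and must leave [F m']
    to a part of size [m']. *)
Hypothesis F_step : forall m m', (2 <= m)%N -> (0 < m')%N ->
  m'%:R - 1 <= (1 - alpha) * (m%:R - 1) -> F m' + g m <= F m.
Hypothesis frag_le : forall S : {set V}, connected_in e S -> (2 <= #|S|)%N ->
  (frag e w alpha S <= (g #|S|)%:E)%E.

(* Cutting [S] into [A] and [B] puts the crossing edges at height [#|S| - 1],
   which costs at most [g #|S| * W(S)]; the rest is paid by the potential [F],
   since [W(A) + W(B) <= W(S)]. *)
Lemma exists_fragmentation_tree (S : {set V}) : connected_in e S ->
  exists H, [/\ uniq (leaves H), leaves H =i S,
    {in S &, forall x y, (graph_dist e x y)%:R <= hheight R H x y}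
    & edge_sum e S (fun x y => w x y * hheight R H x y)
      <= F #|S| * weight_in e w S].
Proof.
have [n] := ubnP #|S|; elim: n S => // n IHn S /ltnSE S_le Sconn.
have [S_le1|S_ge2] := leqP #|S| 1.
  have /cards1P[x Sx] : #|S| == 1%N.
    rewrite eqn_leq S_le1 lt0n cards_eq0; by case/andP: Sconn.
  exists (Leaf x); rewrite Sx; split=> //= [y|y z|]; first by rewrite !inE.
    by move=> /set1P-> /set1P->; rewrite graph_dist_refl /hheight eqxx.
  rewrite (@eq_edge_sum _ _ _ _ _ (fun _ _ => 0)); last first.
    by move=> y z /set1P-> /set1P-> _; rewrite /hheight eqxx mulr0.
  rewrite /edge_sum big1 ?mulr0; last by move=> y _; rewrite big1.
  by rewrite mulr_ge0 ?F_ge0 ?weight_in_ge0.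
have [A [B [/and5P[/eqP defS dAB Aconn Bconn bal] cut_le]]] :=
  frag_leP weight_w Sconn S_ge2 (frag_le Sconn S_ge2).
have A_gt0 : (0 < #|A|)%N by rewrite card_gt0; case/andP: Aconn.
have B_gt0 : (0 < #|B|)%N by rewrite card_gt0; case/andP: Bconn.
have cardS : #|S| = (#|A| + #|B|)%N.
  by rewrite -defS cardsU disjoint_setI0 // cards0 subn0.
have [|l [lU lA ldist lcost]] := IHn A _ Aconn.
  by rewrite (leq_trans _ S_le) // cardS -addn1 leq_add2l.
have [|r [rU rB rdist rcost]] := IHn B _ Bconn.
  by rewrite (leq_trans _ S_le) // cardS -add1n leq_add2r.
have AnB x : x \in A -> x \notin B by move=> xA; rewrite (disjointFr dAB).
have BnA x : x \in B -> x \notin A by move=> xB; rewrite (disjointFl dAB).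
have lrS : leaves l ++ leaves r =i S.
  by move=> z; rewrite mem_cat lA rB -defS inE.
have hA : {in A &, hheight R (Node l r) =2 hheight R l}.
  by move=> x y xA yA; rewrite hheight_left ?lA.
have hB : {in B &, hheight R (Node l r) =2 hheight R r}.
  by move=> x y xB yB; rewrite hheight_right ?rB ?lA ?BnA.
have hAB x y : x \in A -> y \in B -> hheight R (Node l r) x y = #|S|%:R - 1.
  move=> xA yB; rewrite hheight_cross ?lA ?rB ?AnB ?BnA //.
  by congr (_%:R - 1); apply: eq_card => z; rewrite inE lrS.
exists (Node l r); split=> //=.
- rewrite cat_uniq lU rU andbT /=; apply/hasPn => z /=.
  by rewrite rB lA; apply: BnA.
- have cross x y : x \in S -> y \in S ->
      (graph_dist e x y)%:R <= #|S|%:R - 1 :> R.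
    move=> xS yS; rewrite lerBrDr natr1 ler_nat.
    exact: graph_dist_connected Sconn xS yS.
  move=> x y xS yS; have := xS; have := yS; rewrite -defS !inE.
  case/orP=> [yA|yB] /orP[xA|xB].
  + by rewrite hA // ldist.
  + by rewrite hheight_sym hAB // cross.
  + by rewrite hAB // cross.
  + by rewrite hB // rdist.
have [symw w_gt0] := weight_w; have [symE _] := graph_e.
rewrite -{1}defS edge_sumU //; last first.
  by move=> x y exy; rewrite hheight_sym symw.
rewrite (@eq_edge_sum _ _ _ A _ (fun x y => w x y * hheight R l x y)); last first.
  by move=> x y xA yA _; rewrite hA.
rewrite (@eq_edge_sum _ _ _ B _ (fun x y => w x y * hheight R r x y)); last first.
  by move=> x y xB yB _; rewrite hB.
have -> : \sum_(x in A) \sum_(y in B | e x y) w x y * hheight R (Node l r) x y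
    = (#|S|%:R - 1) * cut_weight e w A B.
  rewrite mulrC mulr_suml; apply: eq_bigr => x xA; rewrite mulr_suml.
  by apply: eq_bigr => y /andP[yB _]; rewrite hAB.
have WAB := weight_inU_ge symE weight_w dAB; rewrite defS in WAB.
have WA_ge0 := weight_in_ge0 A weight_w; have WB_ge0 := weight_in_ge0 B weight_w.
move: bal; rewrite ge_max => /andP[balA balB].
have FA : F #|A| <= F #|S| - g #|S| by rewrite lerBrDr F_step.
have FB : F #|B| <= F #|S| - g #|S| by rewrite lerBrDr F_step.
(* This gives [F #|S| - g #|S| >= 0], so [W(A) + W(B) <= W(S)] may be multiplied by it; adding
   [g #|S| * W(S)] for the cut yields [F #|S| * W(S)]. *)
have FA_ge0 := F_ge0 #|A|.
have := ler_wpM2r WA_ge0 FA; have := ler_wpM2r WB_ge0 FB.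
have := ler_wpM2l (le_trans FA_ge0 FA) WAB; lra.
Qed.

Hypothesis connected_V : connected_in e [set: V].
Hypothesis card_V : (2 <= #|V|)%N.

(** Distinct vertices are at distance at least 1. Besides ultrametrics, [u] may be a height
    function, which shows that the hierarchy costs are bounded below. *)
Lemma cost_lbound (u : V -> V -> R) : dominates_dist e u ->
  weight_in e w [set: V] <= cost e w u.
Proof.
case: weight_w graph_e => _ w_gt0 [_ irr] udist; apply: ler_edge_sum => x y _ _ exy.
rewrite ler_peMr ?(ltW (w_gt0 _ _ exy)) // (le_trans _ (udist x y)) // ler1n.
by apply: graph_dist_gt0; apply: contraTneq exy => ->; rewrite irr.
Qed.

Lemma opt_free_ge : weight_in e w [set: V] <= opt_free e w.
Proof.
apply: lb_le_inf => [|_ [u [_ /cost_lbound ?] <-] //].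
(* A feasible point for the infimum: the uniform ultrametric, with [#|V|] as an upper bound for
   every [graph_dist]. *)
pose u (x y : V) : R := if x == y then 0 else #|V|%:R.
have u_ge0 x y : 0 <= u x y by rewrite /u; case: eqP.
have u_ultra x y z : u x y <= Num.max (u x z) (u z y).
  rewrite le_max /u; have [->|] := eqVneq x z; first by rewrite lexx orbT.
  by case: (x == y) => _; rewrite ?lexx ?ler0n.
exists (cost e w u); exists u => //; split.
  split=> //; split=> // [x y|x y|x y z].
  - rewrite /u; split=> [|->]; last by rewrite eqxx.
    case: eqP => // _ /eqP; rewrite pnatr_eq0 => /eqP V0.
    by have := card_V; rewrite V0.
  - by rewrite /u eq_sym.
  - by rewrite (le_trans (u_ultra x y z)) // ge_max lerDl lerDr !u_ge0.
move=> x y; rewrite /u; case: eqP => [->|_]; first by rewrite graph_dist_refl.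
by rewrite ler_nat graph_dist_le_card.
Qed.

Lemma opt_card_le : opt_card e w <= F #|V| * weight_in e w [set: V].
Proof.
have [H [unq memH Hdist Hcost]] := exists_fragmentation_tree connected_V.
rewrite cardsT in Hcost; apply: le_trans Hcost; apply: ge_inf.
  exists 0 => _ [u [_ /cost_lbound]] le_cost <-.
  exact: le_trans (weight_in_ge0 _ weight_w) le_cost.
exists H => //; split; last by move=> x y; apply: Hdist; rewrite inE.
by apply: uniq_perm (enum_uniq _) _ => // x; rewrite memH mem_enum inE.
Qed.

Lemma opt_ratio_le : opt_card e w / opt_free e w <= F #|V|.
Proof.
have W_gt0 : 0 < weight_in e w [set: V] by rewrite weight_in_gt0 ?cardsT.
have free_ge := opt_free_ge.
rewrite ler_pdivrMr; last exact: lt_le_trans free_ge.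
by rewrite (le_trans opt_card_le) // ler_wpM2l.
Qed.

End FragmentationTree.

(** * Potentials for chains of shrinking clusters *)

Section Potentials.
Variables (R : realType) (alpha : R).
Hypothesis alpha01 : 0 < alpha < 1.

(* [Phi t] dominates the sum of [gam] over every chain [t = t_0, t_1, ...] of
   reals [>= 1] with [t_(i+1) <= (1 - alpha) * t_i]: such are the numbers
   [#|S| - 1] for the sets [S] of a balanced hierarchy containing both ends of
   a given edge. *)
Definition chain_potential (Phi gam : R -> R) : Prop :=
  (forall t, 1 <= t -> 0 < gam t <= Phi t) /\
  (forall t t', 1 <= t' -> t' <= (1 - alpha) * t -> Phi t' + gam t <= Phi t).

(** Reduces each of the three bounds to exhibiting a potential; [c] leaves room to replace [Phi] by
    a simpler upper bound. *)
Lemma opt_ratio_chain_potential (V : finType) (e : rel V) (w : V -> V -> R)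
    (K c : R) (Phi gam : R -> R) :
    simple_graph e -> edge_weight e w -> connected_in e [set: V] ->
    (2 <= #|V|)%N ->
    chain_potential Phi gam -> Phi (#|V|%:R - 1) <= c ->
    (forall S : {set V}, connected_in e S -> (2 <= #|S|)%N ->
       (frag e w alpha S <= (K * gam (#|S|%:R - 1))%:E)%E) ->
  opt_card e w / opt_free e w <= K * c.
Proof.
move=> graph_e weight_w connV card_V [gamPhi PhiD] Phi_le frag_le.
have pred_ge1 m : (2 <= m)%N -> (1 : R) <= m%:R - 1.
  by move=> m_ge2; rewrite lerBrDr (ler_nat R 2).
have gamP m : (2 <= m)%N -> 0 < gam (m%:R - 1) <= Phi (m%:R - 1).
  by move/pred_ge1; apply: gamPhi.
(* The sign of [K] is forced by [0 <= frag] on [V] itself, where [gam] is positive. *)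
have K_ge0 : 0 <= K.
  have [gam_gt0 _] := andP (gamP _ card_V).
  have := frag_le [set: V]; rewrite cardsT => /(_ connV card_V) le_frag.
  rewrite -(pmulr_lge0 _ gam_gt0) -lee_fin (le_trans _ le_frag) //.
  by apply: frag_ge0 => //; rewrite cardsT ltnW.
(* A singleton has [t = 0], outside the range [t >= 1] of [Phi]; it has no cut to pay for, so [F] is
   0 there. *)
pose F m := if (m <= 1)%N then 0 else K * Phi (m%:R - 1).
apply: (@le_trans _ _ (F #|V|)); last by rewrite /F leqNgt card_V ler_wpM2l.
apply: (opt_ratio_le (alpha := alpha) (g := fun m => K * gam (m%:R - 1))) => //.
- move=> m; rewrite /F; case: leqP => // /gamP/andP[gam_gt0 le_Phi].
  by rewrite mulr_ge0 // (le_trans _ le_Phi) ?ltW.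
- move=> m m' m_ge2 m'_gt0 bal; rewrite /F [(m <= 1)%N]leqNgt m_ge2 /=.
  case: leqP => [_|m'_ge2]; last by rewrite -mulrDr ler_wpM2l ?PhiD ?pred_ge1.
  by rewrite add0r ler_wpM2l //; have [] := andP (gamP _ m_ge2).
Qed.

(** Each step lowers the logarithm, hence its floor, by at least 1; the summand 1 counts the last
    cluster of the chain. *)
Lemma log_chain_potential : chain_potential
  (fun t => 1 + (Num.floor (logb (1 / (1 - alpha)) t))%:~R) (fun=> 1).
Proof.
have [alpha_gt0 alpha_lt1] := andP alpha01.
have L_gt0 : 0 < ln (1 / (1 - alpha)).
  by apply: ln_gt0; rewrite ltr_pdivlMr ?subr_gt0 // mul1r; lra.
split=> [t t_ge1|t t' t'_ge1 le_t'].
  rewrite ltr01 lerDl ler0z floor_ge0.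
  by apply: divr_ge0; [exact: ln_ge0|exact: ltW].
have t_gt0 : 0 < t by nra.
have le_log : logb (1 / (1 - alpha)) t' + 1 <= logb (1 / (1 - alpha)) t.
  rewrite /logb -[X in _ + X](divff (lt0r_neq0 L_gt0)) -mulrDl.
  rewrite ler_pM2r ?invr_gt0 // -lnM ?posrE; try lra; last first.
    by rewrite div1r invr_gt0; lra.
  rewrite ler_ln ?posrE; try lra; rewrite mul1r ?ler_pdivrMr ?divr_gt0; try lra.
rewrite -addrA lerD2l -(intrD _ _ 1) ler_int floor_ge_int intrD.
by rewrite (le_trans _ le_log) // lerD2r floor_le.
Qed.

Lemma powR_base01 (theta : R) : 0 < theta -> 0 < (1 - alpha) `^ theta < 1.
Proof.
move=> theta_gt0; have [alpha_gt0 alpha_lt1] := andP alpha01.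
rewrite powR_gt0 ?subr_gt0 //=; have pow1 : 1 `^ theta = 1 :> R by rewrite powR1.
by rewrite -[ltRHS]pow1 gt0_ltr_powR ?nnegrE //; lra.
Qed.

(** With [q = (1 - alpha)]^ theta[, the terms decrease at least geometrically with ratio]q[, and]Phi
    t[is the full series starting at]t [^ theta]. *)
Lemma powR_chain_potential (theta : R) : 0 < theta ->
  chain_potential (fun t => t `^ theta / (1 - (1 - alpha) `^ theta))
    (fun t => t `^ theta).
Proof.
move=> theta_gt0; have [alpha_gt0 alpha_lt1] := andP alpha01.
have [q_gt0 q_lt1] := andP (powR_base01 theta_gt0).
set q := _ `^ theta in q_gt0 q_lt1 *.
split=> [t t_ge1|t t' t'_ge1 le_t'].
  have p_gt0 : 0 < t `^ theta by rewrite powR_gt0 //; lra.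
  by rewrite p_gt0 ler_pdivlMr ?subr_gt0 //; nra.
have t_gt0 : 0 < t by nra.
have le_pow : t' `^ theta <= q * t `^ theta.
  by rewrite /q -powRM ?ge0_ler_powR ?nnegrE //; nra.
have -> : t' `^ theta / (1 - q) + t `^ theta
    = (t' `^ theta + (1 - q) * t `^ theta) / (1 - q).
  by field; lra.
rewrite ler_pM2r ?invr_gt0 ?subr_gt0 //; lra.
Qed.

Lemma powRN_chain_potential (eta : R) : 0 < eta ->
  chain_potential
    (fun t => (1 - (1 - alpha) `^ eta / t `^ eta) / (1 - (1 - alpha) `^ eta))
    (fun t => (t `^ eta)^-1).
Proof.
move=> eta_gt0; have [alpha_gt0 alpha_lt1] := andP alpha01.
have [q_gt0 q_lt1] := andP (powR_base01 eta_gt0).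
set q := _ `^ eta in q_gt0 q_lt1 *.
split=> [t t_ge1|t t' t'_ge1 le_t'].
  have p_ge1 : 1 <= t `^ eta.
    have pow1 : 1 `^ eta = 1 :> R by rewrite powR1.
    by rewrite -[leLHS]pow1 ge0_ler_powR ?nnegrE //; lra.
  have p_gt0 : 0 < t `^ eta by lra.
  have : (t `^ eta)^-1 <= 1 by rewrite invf_le1.
  by rewrite invr_gt0 p_gt0 ler_pdivlMr ?subr_gt0 //; lra.
have t_gt0 : 0 < t by nra.
have p'_gt0 : 0 < t' `^ eta by rewrite powR_gt0 //; lra.
have p_gt0 : 0 < t `^ eta by rewrite powR_gt0.
have le_pow : t' `^ eta <= q * t `^ eta.
  by rewrite /q -powRM ?ge0_ler_powR ?nnegrE //; nra.
have le_inv : (t `^ eta)^-1 <= q / t' `^ eta.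
  by rewrite ler_pdivlMr // ler_pdivrMl // mulrC.
have -> : (1 - q / t' `^ eta) / (1 - q) + (t `^ eta)^-1
    = (1 - q / t' `^ eta + (1 - q) * (t `^ eta)^-1) / (1 - q).
  by field; rewrite !lt0r_neq0 //; lra.
rewrite ler_pM2r ?invr_gt0 ?subr_gt0 //; lra.
Qed.

End Potentials.

(** * The three growth regimes of the fragmentation ratio *)

Theorem corollary10 (R : realType) (V : finType) (e : rel V) (w : V -> V -> R)
    (alpha K : R)
    (graph_e : simple_graph e)
    (weight_w : edge_weight e w)
    (card_V : (2 <= #|V|)%N)
    (connected_V : connected_in e [set: V])
    (alpha_gt0 : 0 < alpha)
    (alpha_le_half : alpha <= 1 / 2)
    (has_fragmentation : forall S : {set V},
       connected_in e S -> (2 <= #|S|)%N ->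
       exists A B : {set V}, balanced_fragmentation e alpha S A B) :
  ((forall S : {set V}, connected_in e S -> (2 <= #|S|)%N ->
      (frag e w alpha S <= K%:E)%E) ->
   opt_card e w / opt_free e w <=
     K * (1 + (Num.floor (logb (1 / (1 - alpha)) (#|V|%:R - 1)))%:~R))
  /\
  (forall eta : R, 0 < eta ->
   (forall S : {set V}, connected_in e S -> (2 <= #|S|)%N ->
      (frag e w alpha S <= (K / (#|S|%:R - 1) `^ eta)%:E)%E) ->
   opt_card e w / opt_free e w <=
     K * (1 - alpha) `^ (- eta) / (1 - (1 - alpha) `^ eta))
  /\
  (forall theta : R, 0 < theta ->
   (forall S : {set V}, connected_in e S -> (2 <= #|S|)%N ->
      (frag e w alpha S <= (K * (#|S|%:R - 1) `^ theta)%:E)%E) ->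
   opt_card e w / opt_free e w <=
     K * (#|V|%:R - 1) `^ theta / (1 - (1 - alpha) `^ theta)).
Proof.
have alpha01 : 0 < alpha < 1 by rewrite alpha_gt0; lra.
have bound := opt_ratio_chain_potential graph_e weight_w connected_V card_V.
split=> [frag_le|]; last split=> [eta eta_gt0 frag_le|theta theta_gt0 frag_le].
- apply: bound (log_chain_potential alpha01) (lexx _) _ => S Sconn S_ge2.
  by rewrite mulr1 frag_le.
- rewrite -mulrA; apply: bound (powRN_chain_potential alpha01 eta_gt0) _ frag_le.
  have /andP[q_gt0 q_lt1] := powR_base01 alpha01 eta_gt0.
  rewrite powRN ler_pM2r ?invr_gt0 ?subr_gt0 //.
  apply: (@le_trans _ _ 1); first by rewrite gerBl divr_ge0 ?powR_ge0.
  by rewrite invf_ge1 // ltW.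
- rewrite -mulrA.
  exact: bound (powR_chain_potential alpha01 theta_gt0) (lexx _) frag_le.
Qed.
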